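(* Let $d\ge 3$ and $m\ge 1$ be integers and let $\beta>2$ be real. Let $n$ be an integer with $m+1\le n<2m+2$. There is $p>0$ (depending only on $d,m,\beta,n$) such that, for the CAT Markov chain $(\mathcal C_t)_{t\ge0}$ with parameters $(d,m,\beta)$, $$\mathbf P_C\big(\mathrm{diam}(\mathcal C_n)\le 2n^2\big)\ge p$$ for every $n$-element subset $C$ of $\mathbb Z^d$.
   Context: $\|\cdot\|$ is the Euclidean norm; $\mathrm{diam}(A)=\sup_{x,y\in A}\|x-y\|$. For $A\subset\mathbb Z^d$, $\partial A=\{x\in\mathbb Z^d\setminus A:\ \|x-y\|=1\text{ for some }y\in A\}$. Let $\phi(u,v)=\max\{\|u-v\|,1\}^{-\beta}$ for $u,v\in\mathbb Z^d$. CAT (chain activation and transport) is the Markov chain $(\mathcal C_t)_{t\ge0}$ on $\mathcal S=\{S\subset\mathbb Z^d: m+1\le|S|<\infty\}$ with the following step. Given $\mathcal C_t$, choose $x_1$ uniformly at random in $\mathcal C_t$; for $l=1,\dots,m-1$, given $x_1,\dots,x_l$, choose $x_{l+1}\in\mathcal C_t\setminus\{x_1,\dots,x_l\}$ with probability proportional to $\phi(x_l,x_{l+1})$; then for $l=m,\dots,2m-1$, given $x_1,\dots,x_l$, choose $x_{l+1}\in\partial\big((\mathcal C_t\setminus\{x_1,\dots,x_m\})\cup\{x_{m+1},\dots,x_l\}\big)$ with probability proportional to $\phi(x_l,x_{l+1})$. Set $\mathcal C_{t+1}=(\mathcal C_t\setminus\{x_1,\dots,x_m\})\cup\{x_{m+1},\dots,x_{2m}\}$.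 $\mathbf P_C$ is the law of the chain started from $\mathcal C_0=C$. *)

(* Defs.v *)
From HB Require Import structures.
From mathcomp Require Import all_boot all_order all_algebra.
From mathcomp Require Import finmap.
From mathcomp Require Import all_classical all_reals all_analysis.

Set Implicit Arguments.
Unset Strict Implicit.
Unset Printing Implicit Defensive.

Import Order.TTheory GRing.Theory Num.Theory.

Local Open Scope classical_set_scope.
Local Open Scope ring_scope.

Section CAT.
Variables (R : realType) (d : nat).
Local Notation Zd := 'rV[int]_d.

(* Euclidean norm; the library norm on row vectors is the sup norm. *)
Definition enorm (u : Zd) : R :=
  Num.sqrt (\sum_(i < d) ((u ord0 i)%:~R : R) ^+ 2).

Definition diam (A : {fset Zd}) : R :=
  sup [set enorm (x - y) | x in [set` A] & y in [set` A]].

Definition boundary (A : {fset Zd}) : set Zd :=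
  [set x | x \notin A /\ exists2 y, y \in A & enorm (x - y) = 1].

Definition phi (beta : R) (u v : Zd) : R :=
  Num.max (enorm (u - v)) 1 `^ (- beta).

(* Probability of drawing v from the finite set A when the point w of A has
   probability proportional to phi beta u w. *)
Definition pick_prob (beta : R) (A : set Zd) (u v : Zd) : R :=
  \1_A v * phi beta u v / \sum_(w \in A) phi beta u w.

(* In the definitions below, x is the sequence [:: x_1; ...; x_2m], so that
   x_l is nth 0 x l.-1, {x_1, ..., x_l} is take l x, and {x_(m+1), ..., x_l}
   is drop m (take l x). *)

(* (C \ {x_1, ..., x_m}) U {x_(m+1), ..., x_l} *)
Definition config (m : nat) (C : {fset Zd}) (x : seq Zd) (l : nat) :
    {fset Zd} :=
  ((C `\` [fset z in take m x]) `|` [fset z in drop m (take l x)])%fset.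

(* Joint probability of the choices x_1, ..., x_2m in one step from C. *)
Definition choice_prob (m : nat) (beta : R) (C : {fset Zd}) (x : seq Zd) : R :=
  (\1_[set` C] (nth 0 x 0) / #|` C|%:R)
  * (\prod_(1 <= l < m)
       pick_prob beta [set` (C `\` [fset z in take l x])%fset]
         (nth 0 x l.-1) (nth 0 x l))
  * (\prod_(m <= l < 2 * m)
       pick_prob beta (boundary (config m C x l))
         (nth 0 x l.-1) (nth 0 x l)).

Definition transition (m : nat) (beta : R) (C C' : {fset Zd}) : \bar R :=
  \esum_(x in [set x : seq Zd | size x = (2 * m)%N
                               /\ config m C x (2 * m) = C'])
    (choice_prob m beta C x)%:E.

(* X is a realization, on the probability space (Omega, P), of the CAT Markov
   chain started from C; its countable state space is discrete, so that
   measurability is that of the events {X_t = S}. *)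
Record CAT_chain (m : nat) (beta : R) (C : {fset Zd})
    (disp : measure_display) (Omega : measurableType disp)
    (P : probability Omega R) (X : nat -> Omega -> {fset Zd}) : Prop := {
  CAT_state : forall t w, (m + 1 <= #|` X t w|)%N ;
  CAT_measurable : forall t S, measurable [set w | X t w = S] ;
  CAT_init : P [set w | X 0%N w = C] = 1%E ;
  CAT_markov : forall (t : nat) (s : nat -> {fset Zd}),
    P [set w | forall i, (i <= t.+1)%N -> X i w = s i]
    = (P [set w | forall i, (i <= t)%N -> X i w = s i]
       * transition m beta (s t) (s t.+1))%E
}.

End CAT.

(* Main.v *)
Require Import Defs.
From HB Require Import structures.
From mathcomp Require Import all_boot all_order all_algebra.
From mathcomp Require Import finmap zify lra.
From mathcomp Require Import all_classical all_reals all_analysis.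

Set Implicit Arguments.
Unset Strict Implicit.
Unset Printing Implicit Defensive.

Import Order.TTheory GRing.Theory Num.Theory.

Local Open Scope classical_set_scope.
Local Open Scope ring_scope.

(** Call a pick of [v] from a finite set [A], seen from [u], good if its
    distance to [u] is at most [L] times the smallest one.  If [A] has at most
    [N] points, a good pick has probability at least [1 / (N * L ^ beta)],
    whatever the position of [A].  So it suffices to drive any [C] to a set of
    diameter at most [2 * n ^ 2] by [n] steps made of good picks, for an [L]
    depending only on [n].  After the first step there is a cluster of at least
    [m + 1] points: the [m] transported points and the point next to which they
    land.  Each later step starts from a point outside the cluster (if any), and
    follows nearest points until it enters the cluster, then stays inside.
    Since [n - m <= m + 1], the cluster absorbs at least one new point, and its
    diameter grows by at most [2 * n]. *)

(** * The l1 norm on the lattice *)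

Section L1Norm.
Variables (R : realType) (d : nat).
Implicit Types u v w : 'rV[int]_d.

(** This norm takes values in [nat] and dominates the Euclidean norm, so distance estimates become
    integer arithmetic. *)
Definition l1norm u : nat := (\sum_(i < d) `|u ord0 i|)%N.

Lemma l1normD u v : (l1norm (u + v) <= l1norm u + l1norm v)%N.
Proof.
by rewrite /l1norm -big_split leq_sum // => i _; rewrite mxE /=; lia.
Qed.

Lemma l1normN u : l1norm (- u) = l1norm u.
Proof. by apply: eq_bigr => i _; rewrite mxE abszN. Qed.

Lemma l1norm_distC u v : l1norm (u - v) = l1norm (v - u).
Proof. by rewrite -opprB l1normN. Qed.

Lemma l1norm_triangle w u v :
  (l1norm (u - v) <= l1norm (u - w) + l1norm (w - v))%N.
Proof. by have := l1normD (u - w) (w - v); rewrite addrA subrK. Qed.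

Lemma l1norm0 : l1norm 0 = 0%N.
Proof. by rewrite /l1norm big1 // => i _; rewrite mxE. Qed.

Lemma l1norm_delta_mx (i : 'I_d) k : l1norm (delta_mx 0 i *+ k) = k.
Proof.
rewrite /l1norm (bigD1 i) //= big1 => [|j ji]; rewrite mulmxnE mxE.
  by rewrite !eqxx; lia.
by rewrite (negbTE ji) andbF mul0rn.
Qed.

Lemma enorm_delta_mx (i : 'I_d) : enorm R (delta_mx 0 i) = 1.
Proof.
rewrite /enorm (bigD1 i) //= big1 => [|j ji]; rewrite mxE.
  by rewrite !eqxx addr0 expr1n sqrtr1.
by rewrite (negbTE ji) andbF expr0n.
Qed.

Lemma enorm_le_l1norm u : enorm R u <= (l1norm u)%:R.
Proof.
rewrite -[leRHS]ger0_norm // -sqrtr_sqr ler_wsqrtr // /l1norm natr_sum.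
(* Nonnegativity of the partial sums is carried along, because it makes the cross term in the square
   of a sum nonnegative. *)
suff /andP[] : (0 <= \sum_(i < d) (`|u ord0 i|%N%:R : R)) &&
    (\sum_(i < d) ((u ord0 i)%:~R : R) ^+ 2 <=
     (\sum_(i < d) `|u ord0 i|%N%:R) ^+ 2) by [].
elim/big_ind2: _ => [|a b a' b' /andP[? ?] /andP[? ?]|i _].
- by rewrite lexx expr0n /=.
- by apply/andP; split; nra.
- by rewrite ler0n natr_absz intr_norm real_normK ?num_real ?lexx.
Qed.

(** An integer satisfies |a| <= a ^ 2, so the l1 norm is at most the square of the Euclidean one. *)
Lemma l1norm_le_enorm1 u : enorm R u = 1 -> (l1norm u <= 1)%N.
Proof.
move=> /(congr1 (fun x => x ^+ 2)).
rewrite sqr_sqrtr ?sumr_ge0// => [|i _]; last exact: sqr_ge0.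
rewrite expr1n => u1; rewrite -(ler_nat R) -[leRHS]u1 natr_sum.
apply: ler_sum => i _; rewrite -rmorphXn /= natr_absz ler_int.
nia.
Qed.

End L1Norm.

(** * Outer boundaries of finite sets *)

Section Boundary.
Variables (R : realType) (d : nat).
Implicit Types (u v w : 'rV[int]_d) (A : {fset 'rV[int]_d}).

(** A boundary point is a point of [A] plus a vector with entries in {-1, 0, 1}, and there are 3 ^ d
    such vectors. *)
Lemma boundary_fset A :
  exists2 F : {fset 'rV[int]_d}, boundary R A = [set` F] &
    (#|` F| <= #|` A| * 3 ^ d)%N.
Proof.
pose t := [seq (\row_i ((f i : nat)%:Z - 1) : 'rV[int]_d)
          | f : {ffun 'I_d -> 'I_3} <- enum {ffun 'I_d -> 'I_3}].
pose s := [seq y + b | y <- enum_fset A, b <- t].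
exists [fset x in [seq x <- s | `[< boundary R A x >]]]%fset.
  apply/seteqP; split => x /=; rewrite in_fset /= mem_filter.
    move=> bx; apply/andP; split; first exact/asboolP.
    have [_ [y yA]] := bx; rewrite -[x](subrK y) addrK.
    move: (x - y) => z /l1norm_le_enorm1 z1.
    apply/allpairsP; exists (y, z); split => //=; last by rewrite addrC.
    apply/mapP; exists [ffun i => inord (absz (z ord0 i + 1))].
      by rewrite mem_enum.
    apply/rowP => i; rewrite [RHS]mxE ffunE.
    have : (`|z ord0 i| <= 1)%N.
      by apply: leq_trans z1; rewrite /l1norm (bigD1 i) //= leq_addr.
    rewrite -[LHS]/(z ord0 i); move: (z ord0 i) => a a1; rewrite inordK; lia.
  by case/andP => /asboolP.
rewrite card_fseq (leq_trans (size_undup _)) // size_filter.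
rewrite (leq_trans (count_size _ _)) // size_allpairs size_map -cardE.
by rewrite card_ffun !card_ord.
Qed.

Lemma boundary_unit A y u :
  y \in A -> y + u \notin A -> enorm R u = 1 -> boundary R A (y + u).
Proof. by move=> yA yuA u1; split=> //; exists y => //; rewrite addrC addKr. Qed.

End Boundary.

(** * Good picks and their probability *)

Section PickProb.
Variables (R : realType) (d : nat) (beta : R).
Hypothesis beta_gt0 : 0 < beta.
Implicit Types (u v w : 'rV[int]_d) (A : {fset 'rV[int]_d}).

Lemma phi_gt0 u v : 0 < phi beta u v.
Proof. by rewrite powR_gt0 // lt_max ltr01 orbT. Qed.

(** Distances are truncated at 1 as in [phi], so that a factor [L] between distances becomes a
    factor [L ^ beta] between weights. *)
Definition near_opt (L : R) (A : set 'rV[int]_d) u v := A v /\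
  forall w, A w ->
    Num.max (enorm R (u - v)) 1 <= L * Num.max (enorm R (u - w)) 1.

Lemma phi_near_opt (L : R) (A : set 'rV[int]_d) u v w : 0 < L ->
  near_opt L A u v -> A w -> phi beta u w <= L `^ beta * phi beta u v.
Proof.
move=> L0 [_ +] Aw => /(_ w Aw); rewrite /phi !powRN.
set a := Num.max _ _; set b := Num.max _ _ => ab.
have a0 : 0 < a by rewrite /a lt_max ltr01 orbT.
have b0 : 0 < b by rewrite /b lt_max ltr01 orbT.
rewrite -ler_pdivrMl ?powR_gt0 // -invfM lef_pV2 ?posrE ?mulr_gt0 ?powR_gt0 //.
rewrite -powRM ?(ltW L0) ?(ltW b0) //.
by apply: (ge0_ler_powR (ltW beta_gt0)) => //;
  rewrite ?nnegrE ?mulr_ge0 // ltW.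
Qed.

(** Each of the at most [N] weights in the normalising sum is at most [L ^ beta] times the weight of
    [v]. *)
Lemma pick_prob_ge (L : R) (N : nat) A u v : 0 < L -> (#|` A| <= N)%N ->
  near_opt L [set` A] u v ->
  (N%:R * L `^ beta)^-1 <= pick_prob beta [set` A] u v.
Proof.
move=> L0 AN uv; have [vA _] := uv.
rewrite /pick_prob indicE mem_set // mul1r -fsbig_seq ?fset_uniq //=.
have N0 : (0 < N)%N.
  by apply: leq_trans AN; rewrite cardfs_gt0; apply/fset0Pn; exists v.
have S0 : 0 < \sum_(w <- A) phi beta u w.
  rewrite (big_fsetD1 v) //= ltr_pwDl ?phi_gt0 // sumr_ge0 // => w _.
  exact/ltW/phi_gt0.
rewrite ler_pdivlMr // ler_pdivrMl ?mulr_gt0 ?ltr0n ?powR_gt0 //.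
rewrite -mulrA mulr_natl.
apply: le_trans (_ : \sum_(w <- A) L `^ beta * phi beta u v <= _).
  rewrite big_seq [leRHS]big_seq; apply: ler_sum => w wA.
  exact: phi_near_opt uv _.
rewrite big_const_seq count_predT iter_addr addr0 ler_wpMn2l //.
by rewrite mulr_ge0 ?powR_ge0 // ltW ?phi_gt0.
Qed.

(** Truncated distances are at least 1, so an absolute bound [M] is also a relative one, wherever
    the rest of [A] lies. *)
Lemma near_opt_close (M : nat) (A : set 'rV[int]_d) u v : (0 < M)%N -> A v ->
  (l1norm (u - v) <= M)%N -> near_opt M%:R A u v.
Proof.
move=> M0 Av uvM; split => // w _; apply: le_trans (_ : M%:R <= _).
  rewrite ge_max ler1n M0 andbT (le_trans (enorm_le_l1norm _ _)) //.
  by rewrite ler_nat.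
by rewrite ler_peMr // le_max lexx orbT.
Qed.

Lemma near_opt_exists (L : R) A u : 1 <= L -> A != fset0 ->
  exists v, near_opt L [set` A] u v.
Proof.
move=> L1; rewrite -cardfs_gt0 cardfE => /card_gt0P [v0 _].
pose f (v : A) := Num.max (enorm R (u - val v)) 1.
case: (@Order.TotalTheory.arg_minP _ _ _ v0 xpredT f isT) => v _ vP.
exists (val v); split; first exact: valP.
move=> w wA; apply: le_trans (vP [` wA]%fset isT) _.
by rewrite /f ler_peMl // le_max ler01 orbT.
Qed.

End PickProb.

(** * Lower bound for one transition *)

Section ChoiceProb.
Variables (R : realType) (d m : nat) (beta : R).
Hypothesis beta_gt0 : 0 < beta.

Definition admissible (L : R) (C : {fset 'rV[int]_d}) (x : seq 'rV[int]_d) :=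
  [/\ size x = (2 * m)%N, nth 0 x 0 \in C,
    forall l, (0 < l < m)%N ->
      near_opt L [set` (C `\` [fset z in take l x])%fset]
        (nth 0 x l.-1) (nth 0 x l) &
    forall l, (m <= l < 2 * m)%N ->
      near_opt L (boundary R (config m C x l)) (nth 0 x l.-1) (nth 0 x l)].

(** The factor 1 / n is for the uniform choice of x_1; the others are for the m - 1 activation and
    2m - m transport picks, each from at most n * 3 ^ d points. *)
Definition step_bound (L : R) n : R :=
  n%:R^-1 * ((n * 3 ^ d)%N%:R * L `^ beta)^-1 ^+ (m - 1 + (2 * m - m)).

Lemma step_bound_gt0 L n : 0 < L -> (0 < n)%N -> 0 < step_bound L n.
Proof.
move=> L0 n0; rewrite /step_bound mulr_gt0 ?invr_gt0 ?ltr0n //.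
by rewrite exprn_gt0 // invr_gt0 mulr_gt0 ?powR_gt0 // ltr0n muln_gt0 n0 expn_gt0.
Qed.

Lemma transition_ge (L : R) C x : 0 < L ->
  (forall l, (m <= l < 2 * m)%N -> (#|` config m C x l| <= #|` C|)%N) ->
  admissible L C x ->
  ((step_bound L #|` C|)%:E <= transition m beta C (config m C x (2 * m)))%E.
Proof.
(* A single sequence of choices already gives the bound. *)
move=> L0 cfg [sx x0 act trp]; apply: esum_ge; exists [set x].
  by split; [exact: finite_set1|move=> y /= ->].
rewrite fsbig_set1 lee_fin /step_bound /choice_prob indicE mem_set // mul1r.
rewrite exprD mulrA; set q := (_ * _)^-1.
have q0 : 0 <= q by rewrite invr_ge0 mulr_ge0 ?powR_ge0.
have C0 : 0 <= #|` C|%:R^-1 :> R by rewrite invr_ge0.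
rewrite -!prodr_const_nat; apply: ler_pM; rewrite ?mulr_ge0 ?prodr_ge0 //.
  rewrite ler_wpM2l // big_nat_cond [leRHS]big_nat_cond.
  apply: ler_prod => l; rewrite andbT => lm; rewrite q0 /=.
  apply: pick_prob_ge (act l lm) => //.
  rewrite (leq_trans (fsubset_leq_card (fsubsetDl _ _))) //.
  by rewrite leq_pmulr // expn_gt0.
rewrite big_nat_cond [leRHS]big_nat_cond.
apply: ler_prod => l; rewrite andbT => lm; rewrite q0 /=.
have [F bF cF] := boundary_fset R (config m C x l).
have := trp l lm; rewrite bF => /pick_prob_ge; apply=> //.
by rewrite (leq_trans cF) // leq_mul2r cfg ?orbT.
Qed.

End ChoiceProb.

(** * The activation and transport halves of a step *)

Section OneStep.
Variables (R : realType) (d : nat).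
Implicit Types (u v w y z : 'rV[int]_d) (C K S : {fset 'rV[int]_d}).
Implicit Types (a b : seq 'rV[int]_d).

Definition clustered (D : nat) K :=
  forall y z, y \in K -> z \in K -> (l1norm (y - z) <= D)%N.

Lemma card_fset_uniq (s : seq 'rV[int]_d) :
  uniq s -> #|` [fset z in s]%fset| = size s.
Proof. by move=> us; rewrite card_fseq undup_id. Qed.

Lemma ex_notin (s : seq 'rV[int]_d) S : (size s < #|` S|)%N ->
  exists2 y, y \in S & y \notin s.
Proof.
move=> sS; have : (0 < #|` (S `\` [fset z in s])%fset|)%N.
  rewrite cardfsD subn_gt0 (leq_ltn_trans _ sS) //.
  rewrite (leq_trans (fsubset_leq_card (fsubsetIr _ _))) //.
  by rewrite card_fseq size_undup.
rewrite cardfs_gt0 => /fset0Pn [y]; rewrite !inE /= => /andP[ys yS].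
by exists y.
Qed.

(** The first #|S| + 1 points of the ray are distinct, so the ray leaves [S] among them; its first
    point outside [S] is adjacent to the one before, which is in [S]. *)
Lemma ex_boundary_ray (e : 'rV[int]_d) S q : enorm R e = 1 ->
  (forall k, l1norm (e *+ k) = k) -> q \in S ->
  exists2 k, (k <= #|` S|)%N & boundary R S (q + e *+ k).
Proof.
move=> e1 ek qS.
have [k kS kN] : exists2 k, (k <= #|` S|)%N & q + e *+ k \notin S.
  apply: contrapT => nex.
  pose s := [seq q + e *+ k | k <- iota 0 (#|` S|).+1].
  have us : uniq s.
    rewrite map_inj_uniq ?iota_uniq // => i j /addrI.
    by move=> /(congr1 (@l1norm d)); rewrite !ek.
  have /(uniq_leq_size us) : {subset s <= S}.
    move=> _ /mapP[k + ->]; rewrite mem_iota => /andP[_ kS].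
    by apply: contrapT => /negP kN; apply: nex; exists k.
  by rewrite size_map size_iota ltnn.
have ex : exists k, q + e *+ k \notin S by exists k.
have [j jN jmin] := ex_minnP ex; exists j; first exact: leq_trans (jmin k kN) kS.
case: j jN jmin => [|j jN jmin]; first by rewrite mulr0n addr0 qS.
move: jN; rewrite mulrSr addrA => jN; apply: boundary_unit => //.
by apply: contrapT => /negP /jmin; rewrite ltnn.
Qed.

(* Following the nearest remaining point, but staying in K once K is entered,
   which costs a factor at most M because K has diameter at most M. *)
Lemma activation (M m : nat) C K x1 : (0 < M)%N -> (K `<=` C)%fset ->
  clustered M K -> K = fset0 \/ (m < #|` K|)%N ->
  (m <= #|` C|)%N -> x1 \in C ->
  forall k, (k < m)%N -> exists a,
    [/\ size a = k.+1, uniq a, {subset a <= C}, nth 0 a 0 = x1 &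
      forall l, (0 < l < k.+1)%N ->
        near_opt (M%:R : R) [set` (C `\` [fset z in take l a])%fset]
          (nth 0 a l.-1) (nth 0 a l)] /\
    (last 0 a \in K \/ forall z, z \in a -> z \notin K).
Proof.
move=> M0 KC KM Km mC x1C; elim=> [|k IH] km.
  exists [:: x1]; split; last first.
    case: (boolP (x1 \in K)) => x1K; [by left|right=> z].
    by rewrite inE => /eqP ->.
  split=> //; first by move=> z; rewrite inE => /eqP ->.
  by case=> [|l].
have [a [[sa ua aC a0 agood] aK]] := IH (ltnW km).
have sak : (size a < m)%N by rewrite sa.
suff [v [vgood vK]] : exists v,
    near_opt (M%:R : R) [set` (C `\` [fset z in a])%fset] (last 0 a) v /\
    (v \in K \/ forall z, z \in rcons a v -> z \notin K).
  have [] := vgood; rewrite /= !inE /= => /andP[va vC] _.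
  exists (rcons a v); split; last by rewrite last_rcons.
  split.
  - by rewrite size_rcons sa.
  - by rewrite rcons_uniq va.
  - by move=> z; rewrite mem_rcons inE => /orP[/eqP ->|/aC].
  - by rewrite nth_rcons sa.
  move=> l /andP[l0]; rewrite ltnS leq_eqVlt => /orP[/eqP ->|lk].
    rewrite -cats1 take_size_cat // cats1 !nth_rcons sa ltnn eqxx /=.
    by rewrite leqnn -[k]/(k.+1.-1) -sa nth_last.
  rewrite -cats1 takel_cat ?sa ?(ltnW lk) // cats1 !nth_rcons sa lk.
  by rewrite (leq_ltn_trans (leq_pred l) lk); apply: agood; rewrite l0.
have [uK|uK] := boolP (last 0 a \in K).
  have [v vK va] : exists2 v, v \in K & v \notin a.
    apply: ex_notin; case: Km => [K0|]; first by rewrite K0 in uK.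
    exact: ltn_trans.
  exists v; split; last by left.
  apply: near_opt_close => //; last exact: KM.
  by rewrite /= !inE va (fsubsetP KC).
(* The chain has not met [K] yet, so the nearest remaining point may be picked: whether or not it
   lies in [K], the alternative is preserved. *)
have {}aK : forall z, z \in a -> z \notin K by case: aK => // aK; rewrite aK in uK.
have [v0 v0C v0a] := ex_notin (leq_trans sak mC).
have [||v vgood] :=
    @near_opt_exists R d (M%:R : R) (C `\` [fset z in a])%fset (last 0 a).
- by rewrite ler1n.
- by apply/fset0Pn; exists v0; rewrite !inE v0a.
exists v; split=> //; case: (boolP (v \in K)) => vK; [by left|right=> z].
by rewrite mem_rcons inE => /orP[/eqP ->|/aK].
Qed.

(** Every new point is the first exit of the ray from [b1], hence within [N] of [b1]. Consecutive
    points are then at distance at most 2 * N <= M, so each pick after [b1] is good. *)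
Lemma transport (e : 'rV[int]_d) (N M : nat) S (b1 : 'rV[int]_d) : enorm R e = 1 ->
  (forall k, l1norm (e *+ k) = k) -> (0 < M)%N -> (2 * N <= M)%N ->
  boundary R S b1 ->
  forall k, (#|` S| + k <= N)%N -> exists b,
    [/\ size b = k.+1, uniq b, forall z, z \in b -> z \notin S,
        forall z, z \in b -> (l1norm (z - b1) <= N)%N &
        nth 0 b 0 = b1 /\ forall j, (0 < j < k.+1)%N ->
          near_opt (M%:R : R) (boundary R (S `|` [fset z in take j b])%fset)
            (nth 0 b j.-1) (nth 0 b j)].
Proof.
move=> e1 ek M0 NM b1S; elim=> [|k IH] SkN.
  exists [:: b1]; split => //.
  - by move=> z; rewrite inE => /eqP ->; case: b1S.
  - by move=> z; rewrite inE => /eqP ->; rewrite subrr l1norm0.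
  - by split=> //; case.
have [|b [sb ub bS bN [b0 bgood]]] := IH; first by lia.
set T := (S `|` [fset z in b])%fset.
have b1b : b1 \in b by rewrite -b0 mem_nth // sb.
have b1T : b1 \in T by rewrite !inE b1b orbT.
have cT : (#|` T| <= N)%N.
  rewrite (leq_trans (leq_card_fsetU _ _).1) // card_fset_uniq // sb; lia.
have [j jT vT] := ex_boundary_ray e1 ek b1T.
set v := b1 + e *+ j in vT; have [vNT _] := vT.
have vN : (l1norm (v - b1) <= N)%N by rewrite /v addrC addKr ek (leq_trans jT).
have /norP[vS vb] : ~~ ((v \in S) || (v \in b)) by rewrite !inE in vNT.
exists (rcons b v); split.
- by rewrite size_rcons sb.
- by rewrite rcons_uniq vb.
- by move=> z; rewrite mem_rcons inE => /orP[/eqP ->|/bS].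
- by move=> z; rewrite mem_rcons inE => /orP[/eqP ->|/bN].
split; first by rewrite nth_rcons sb.
move=> l /andP[l0]; rewrite ltnS leq_eqVlt => /orP[/eqP ->|lk].
  rewrite -cats1 take_size_cat // cats1 !nth_rcons sb ltnn eqxx leqnn.
  apply: near_opt_close => //.
  apply: leq_trans (l1norm_triangle b1 _ _) _; apply: leq_trans NM.
  rewrite mul2n -addnn leq_add //; last by rewrite l1norm_distC.
  by apply: bN; rewrite mem_nth // sb.
rewrite -cats1 takel_cat ?sb ?(ltnW lk) // cats1 !nth_rcons sb lk.
by rewrite (leq_ltn_trans (leq_pred l) lk); apply: bgood; rewrite l0.
Qed.

Lemma config_cat C a b j : config (size a) C (a ++ b) (size a + j) =
  (C `\` [fset z in a] `|` [fset z in take j b])%fset.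
Proof.
rewrite /config take_size_cat // take_cat ltnNge leq_addr /= addKn.
by rewrite drop_size_cat.
Qed.

End OneStep.

(** * Growth of the cluster in one step *)

Section Gathering.
Variables (R : realType) (d : nat).
Implicit Types (C K : {fset 'rV[int]_d}).

Lemma clustered_fset1 D (y : 'rV[int]_d) : clustered D [fset y]%fset.
Proof. by move=> p q; rewrite !inE => /eqP -> /eqP ->; rewrite subrr l1norm0. Qed.

(** From [B] to [K], go through [b1] and then [y]: this costs N + N + D. Two points of [B] are
    joined through [b1] alone. *)
Lemma clusteredU D N (y b1 : 'rV[int]_d) K B : clustered D K -> y \in K ->
  (l1norm (b1 - y) <= N)%N ->
  (forall z, z \in B -> (l1norm (z - b1) <= N)%N) ->
  clustered (D + 2 * N) (K `|` B)%fset.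
Proof.
move=> KD yK b1y BN.
have BK p q : p \in B -> q \in K -> (l1norm (p - q) <= D + 2 * N)%N.
  move=> /BN pN /KD - /(_ y yK); rewrite l1norm_distC => qy.
  apply: leq_trans (l1norm_triangle b1 _ _) _.
  rewrite addnC mul2n -addnn addnA leq_add // (leq_trans (l1norm_triangle y _ _)) //.
  by rewrite addnC leq_add.
move=> p q; rewrite !inE => /orP[pK|pB] /orP[qK|qB].
- by rewrite (leq_trans (KD _ _ pK qK)) // leq_addr.
- by rewrite l1norm_distC BK.
- exact: BK.
apply: leq_trans (l1norm_triangle b1 _ _) _.
rewrite mul2n -addnn (leq_trans _ (leq_addl _ _)) // leq_add ?BN //.
by rewrite l1norm_distC BN.
Qed.

(* If the activated chain ends in K, then it misses part of K and is put back
   within bounded distance of that part, so K gains its starting point, taken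
   outside K. If it ends outside K, it never met K; then either K is empty and
   a cluster of m + 1 points is born, or K is exactly what is left of C. *)
Lemma gathering_step (m n D M : nat) C K : (0 < d)%N -> (0 < m)%N ->
  (m < n)%N -> (n < 2 * m + 2)%N -> #|` C| = n -> (K `<=` C)%fset ->
  clustered D K -> K = fset0 \/ (m < #|` K|)%N -> (D + 2 * n <= M)%N ->
  exists x : seq 'rV[int]_d, let C' := config m C x (2 * m) in
    [/\ admissible m (M%:R : R) C x,
      forall l, (m <= l < 2 * m)%N -> (#|` config m C x l| <= n)%N,
      #|` C'| = n &
      exists2 K', (K' `<=` C')%fset & clustered (D + 2 * n) K' /\
        (minn n (maxn m.+1 #|` K|.+1) <= #|` K'|)%N].
Proof.
move=> d0 m0 mn n2m Cn KC KD Km DM.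
have M0 : (0 < M)%N by lia.
pose e : 'rV[int]_d := delta_mx 0 (Ordinal d0).
have e1 : enorm R e = 1 by exact: enorm_delta_mx.
have ek k : l1norm (e *+ k) = k by exact: l1norm_delta_mx.
have [x1 x1C x1K] : exists2 x1, x1 \in C & x1 \in K -> K = C.
  have [CK|/fsubsetPn[x1 x1C x1K]] := boolP (C `<=` K)%fset.
    have /fset0Pn[x1 x1C] : C != fset0 by rewrite -cardfs_gt0; lia.
    by exists x1 => // _; apply/eqP; rewrite eqEfsubset KC.
  by exists x1 => //; rewrite (negbTE x1K).
have [|||a [[sa ua aC a0 agood] aK]] :=
    @activation R d M m C K x1 M0 KC _ Km _ x1C m.-1 _.
- by move=> p q pK qK; apply: leq_trans (KD _ _ pK qK) _; lia.
- by rewrite Cn ltnW.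
- by rewrite prednK.
rewrite prednK // in sa agood.
have aCs : ([fset z in a] `<=` C)%fset.
  by apply/fsubsetP => z; rewrite !inE => /aC.
set S := (C `\` [fset z in a])%fset.
have cS : #|` S| = (n - m)%N by rewrite cardfsDS // card_fset_uniq // Cn sa.
have S0 : S != fset0 by rewrite -cardfs_gt0 cS subn_gt0.
set u := last 0 a.
(* It remains to choose the landing point [b1] of x_(m+1) and a surviving cluster [K0] near it; the
   [m] transported points are then added to [K0]. *)
suff [b1 [K0 [ub1 K0S [K0D [y yK0 b1y]] cK0]]] : exists b1 K0,
    [/\ near_opt (M%:R : R) (boundary R S) u b1, (K0 `<=` S)%fset,
      clustered D K0 /\ exists2 y, y \in K0 & (l1norm (b1 - y) <= n)%N &
      (minn n (maxn m.+1 #|` K|.+1) <= #|` K0| + m)%N].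
  have [||b [sb ub bS bN [b0 bgood]]] :=
    @transport R d e n M S b1 e1 ek M0 _ ub1.1 m.-1 _; [lia|lia|].
  rewrite prednK // in sb bgood.
  have cfg j : config m C (a ++ b) (m + j) = (S `|` [fset z in take j b])%fset.
    by rewrite -sa config_cat.
  have SB : [disjoint S & [fset z in b]]%fset.
    apply/fdisjointP => z zS; rewrite !inE; apply/negP => /bS.
    by rewrite zS.
  exists (a ++ b) => C'.
  have C'E : C' = (S `|` [fset z in b])%fset.
    by rewrite /C' mul2n -addnn cfg take_oversize ?sb.
  have cC' : #|` C'| = n.
    by rewrite C'E cardfsU disjoint_fsetI0 // cardfs0 subn0 cS card_fset_uniq //
      sb subnK // ltnW.
  split => //.
  - split.
    + by rewrite size_cat sa sb mul2n addnn.
    + by rewrite nth_cat sa m0 a0.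
    + move=> l /andP[l0 lm]; rewrite !nth_cat sa lm takel_cat ?sa ?(ltnW lm) //.
      by rewrite (leq_ltn_trans (leq_pred l) lm); apply: agood; rewrite l0.
    move=> l /andP[ml l2m]; rewrite -(subnKC ml) cfg !nth_cat sa.
    (* For l = m the preceding point is the last activated one, [u]; afterwards it is a transported
       one. *)
    case: (posnP (l - m)) => [->|lm0].
      rewrite addn0 take0 ltnn subnn b0 prednK // leqnn -sa nth_last -/u.
      by rewrite fset_nil fsetU0.
    rewrite addKn.
    have -> : (m + (l - m) < m)%N = false by lia.
    have -> : ((m + (l - m)).-1 < m)%N = false by lia.
    have -> : ((m + (l - m)).-1 - m = (l - m).-1)%N by lia.
    by apply: bgood; lia.
  - move=> l /andP[ml _]; rewrite -(subnKC ml) cfg -cC' C'E.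
    apply: fsubset_leq_card; apply: fsetUS; apply/fsubsetP => z.
    by rewrite !inE => /mem_take.
  exists (K0 `|` [fset z in b])%fset; first by rewrite C'E fsetSU.
  split.
    by apply: clusteredU K0D yK0 b1y _ => z; rewrite inE; exact: bN.
  have K0B : [disjoint K0 & [fset z in b]]%fset by exact: fdisjointWl SB.
  by rewrite cardfsU disjoint_fsetI0 // cardfs0 subn0 card_fset_uniq // sb.
have [uK|uK] := boolP (u \in K).
  have {}Km : (m < #|` K|)%N by case: Km => // K0; rewrite K0 in uK.
  have [y yK ya] : exists2 y, y \in K & y \notin a by apply: ex_notin; rewrite sa.
  have yS : y \in S by rewrite !inE ya (fsubsetP KC).
  have [k kS kb] := ex_boundary_ray e1 ek yS.
  have kn : (k <= n)%N by rewrite (leq_trans kS) // cS leq_subr.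
  exists (y + e *+ k), (K `\` [fset z in a])%fset; split.
  (* Both [u] and [y] lie in [K], and the ray adds k <= n, so the landing distance is at most D + n
     <= M. *)
  - apply: near_opt_close => //; apply: leq_trans (l1norm_triangle y _ _) _.
    by rewrite opprD addrA subrr sub0r l1normN ek (leq_trans _ DM) //
      leq_add ?KD //; lia.
  - exact: fsetSD.
  - split; first by move=> p q; rewrite !inE => /andP[_ pK] /andP[_ qK]; exact: KD.
    exists y; first by rewrite !inE ya.
    by rewrite addrC addKr ek.
  (* If x1 is in [K], then K = C and all n - m remaining points are kept. Otherwise x1 is one of the
     [m] removed points, so [K] loses at most m - 1 and gains [m]. *)
  have [x1K'|x1K'] := boolP (x1 \in K); first by rewrite (x1K x1K') cS; lia.
  suff : (#|` (K `&` [fset z in a])%fset| < m)%N by rewrite cardfsD; lia.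
  rewrite -sa -(card_fset_uniq ua); apply: fproper_ltn_card.
  rewrite fproperE fsubsetIr; apply/fsubsetPn.
  by exists x1; rewrite !inE ?(negbTE x1K') // -a0 mem_nth // sa.
have {}aK : forall z, z \in a -> z \notin K.
  by case: aK => // aK; rewrite /u aK in uK.
have KS : (K `<=` S)%fset.
  apply/fsubsetP => z zK; rewrite !inE (fsubsetP KC) // andbT.
  by apply/negP => /aK; rewrite zK.
have [F bF _] := boundary_fset R S.
have [||b1 ub1] := @near_opt_exists R d (M%:R : R) F u.
- by rewrite ler1n.
- have /fset0Pn[y yS] := S0; have [k _] := ex_boundary_ray e1 ek yS.
  by rewrite bF => kF; apply/fset0Pn; exists (y + e *+ k).
rewrite -bF in ub1.
have [_ [y yS /l1norm_le_enorm1 b1y]] := ub1.1.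
have {}b1y : (l1norm (b1 - y) <= n)%N by lia.
case: Km => Km.
  exists b1, [fset y]%fset; split => //; first by rewrite fsub1set.
  - by split; [exact: clustered_fset1|exists y => //; rewrite inE].
  - by rewrite Km cardfs0 cardfs1; lia.
(* Here n < 2 * m + 2 enters: [S] has n - m <= m + 1 points, no more than [K]. *)
have KSE : K = S.
  apply/eqP; rewrite eqEfcard KS /= cS (leq_trans _ Km) //; lia.
exists b1, K; split => //; first by split => //; exists y => //; rewrite KSE.
by rewrite KSE cS; lia.
Qed.

End Gathering.

(** * From single steps to the probability of a path *)

Section Trajectory.
Variables (R : realType) (d m : nat) (beta : R).
Hypotheses (d_gt0 : (0 < d)%N) (m_gt0 : (0 < m)%N) (beta_gt0 : 0 < beta).
Implicit Types (C S : {fset 'rV[int]_d}) (s : nat -> {fset 'rV[int]_d}).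

(** The first step creates at least m + 1 clustered points and each later one adds at least one, up
    to [n]. The diameter bound grows by 2 * n per step, so M = 2 * n ^ 2 serves for all [n] steps
    and the bound does not depend on [C]. *)
Lemma gathering_path (n : nat) C : (m < n)%N -> (n < 2 * m + 2)%N ->
  #|` C| = n -> forall t, (t <= n)%N -> exists s,
    [/\ s 0 = C, #|` s t| = n,
      forall i, (i < t)%N ->
        ((step_bound d m beta (2 * n ^ 2)%N%:R n)%:E
          <= transition m beta (s i) (s i.+1))%E &
      exists2 K, (K `<=` s t)%fset & clustered (t * (2 * n)) K /\
        (if t is t'.+1 then (minn n (m + t) <= #|` K|)%N else K = fset0)].
Proof.
move=> mn n2m Cn; elim=> [|t IH] tn.
  exists (fun=> C); split => //; exists fset0; first exact: fsub0set.
  by split=> [p q|//]; rewrite inE.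
have [s [s0 cs st [K Ks [KD cK]]]] := IH (ltnW tn).
have Km : K = fset0 \/ (m < #|` K|)%N by case: (t) cK => [|t'] cK; [left|right; lia].
have [|x [adm cfg cC' [K' K'C' [K'D cK']]]] :=
  @gathering_step R d m n _ (2 * n ^ 2) _ K d_gt0 m_gt0 mn n2m cs Ks KD Km.
  by rewrite -mulSnr mulnCA leq_mul2l -mulnn leq_mul2r tn orbT.
exists (fun i => if (i <= t)%N then s i else config m (s t) x (2 * m)).
rewrite ltnn leq0n; split=> // [i|].
  move=> iSt; have [it|ti] := ltnP i t.
    by rewrite (ltnW it); exact: st.
  have -> : i = t by lia.
  have := transition_ge beta_gt0 _ _ adm; rewrite leqnn cs; apply=> //.
  by rewrite ltr0n; lia.
exists K' => //; split; first by rewrite mulSnr.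
apply: leq_trans cK'; case: (t) cK => [|t'] cK; lia.
Qed.

Variables (disp : measure_display) (Omega : measurableType disp).
Variables (P : probability Omega R) (X : nat -> Omega -> {fset 'rV[int]_d}).
Variable C : {fset 'rV[int]_d}.
Hypothesis chainX : CAT_chain m beta C P X.

Lemma measurable_path s t : measurable [set w | forall i, (i <= t)%N -> X i w = s i].
Proof.
have -> : [set w | forall i, (i <= t)%N -> X i w = s i] =
    \bigcap_(i in `I_t.+1) [set w | X i w = s i] by [].
by apply: fin_bigcap_measurable => // i _; exact: CAT_measurable chainX _ _.
Qed.

(** There are countably many states, so the event is a countable union of events {X_t = S}; states
    outside [Q] contribute the empty set. *)
Lemma measurable_state t (Q : set {fset 'rV[int]_d}) :
  measurable [set w | Q (X t w)].
Proof.
have -> : [set w | Q (X t w)] =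
    \bigcup_S (if `[< Q S >] then [set w | X t w = S] else set0).
  apply/seteqP; split=> [w QX|w [S _]]; first by exists (X t w); rewrite ?asboolT.
  by case: asboolP => // QS /= ->.
apply: countable_bigcupT_measurable; first exact: countableP.
by move=> S; case: ifP => // _; exact: CAT_measurable chainX _ _.
Qed.

Lemma path_prob_ge s (c : R) t : 0 <= c -> s 0 = C ->
  (forall i, (i < t)%N -> (c%:E <= transition m beta (s i) (s i.+1))%E) ->
  ((c ^+ t)%:E <= P [set w | forall i, (i <= t)%N -> X i w = s i])%E.
Proof.
move=> c0 s0; elim: t => [|t IH] st.
  rewrite expr0 -(CAT_init chainX) -s0 le_measure ?inE //.
  - exact: CAT_measurable chainX _ _.
  - exact: measurable_path.
  by move=> w /= X0 i; rewrite leqn0 => /eqP ->.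
rewrite (CAT_markov chainX) exprSr EFinM lee_pmul ?lee_fin ?exprn_ge0 //.
  by apply: IH => i it; apply: st; exact: ltnW.
exact: st.
Qed.

End Trajectory.

(** * The diameter bound after [n] steps *)

Lemma diam_le_clustered (R : realType) (d D : nat) (S : {fset 'rV[int]_d}) :
  S != fset0 -> clustered D S -> diam R S <= D%:R.
Proof.
move=> /fset0Pn[y yS] SD; apply: ge_sup.
  by exists (enorm R (y - y)), y => //; exists y.
move=> _ [p pS [q qS <-]]; apply: le_trans (enorm_le_l1norm R _) _.
by rewrite ler_nat SD.
Qed.

Theorem theorem1p2 (R : realType) (d m : nat) (beta : R) (n : nat)
  (hd : (3 <= d)%N) (hm : (1 <= m)%N) (hbeta : 2 < beta)
  (hn1 : (m + 1 <= n)%N) (hn2 : (n < 2 * m + 2)%N) :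
  exists2 p : R, 0 < p &
    forall (C : {fset 'rV[int]_d}), #|` C| = n ->
    forall (disp : measure_display) (Omega : measurableType disp)
      (P : probability Omega R) (X : nat -> Omega -> {fset 'rV[int]_d}),
      CAT_chain m beta C P X ->
      (p%:E <= P [set w | (diam R (X n w) <= 2 * n%:R ^+ 2)%R])%E.
Proof.
have beta_gt0 : 0 < beta by apply: lt_trans hbeta.
have d_gt0 : (0 < d)%N by apply: leq_trans hd.
have mn : (m < n)%N by rewrite -addn1.
pose c : R := step_bound d m beta (2 * n ^ 2)%N%:R n.
have n_gt0 : (0 < n)%N by apply: leq_ltn_trans mn.
have c_gt0 : 0 < c by rewrite step_bound_gt0 // ltr0n muln_gt0 expn_gt0 n_gt0.
(* One factor [c] for each of the [n] steps. *)
exists (c ^+ n); first exact: exprn_gt0.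
move=> C Cn disp Omega P X chainX.
have [s [s0 cs st [K Ks [KD cK]]]] :=
  gathering_path d_gt0 hm beta_gt0 mn hn2 Cn (leqnn n).
apply: le_trans (path_prob_ge chainX (ltW c_gt0) s0 st) _.
rewrite le_measure ?inE //.
- exact: measurable_path chainX _ _.
- exact: (measurable_state chainX n [set S | diam R S <= 2 * n%:R ^+ 2]).
move=> w /= /(_ n (leqnn n)) ->.
(* After [n] steps the cluster has at least minn n (m + n) = n points, so it is the whole state. *)
have KE : K = s n.
  apply/eqP; rewrite eqEfcard Ks /= cs; case: (n) n_gt0 cK => // n' _ /=; lia.
rewrite KE in KD; apply: le_trans (diam_le_clustered R _ KD) _.
  by rewrite -cardfs_gt0 cs.
by rewrite mulnCA natrM natrM -expr2.
Qed.
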